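(* Let $(\lambda^{(n)})_{n\ge 1}$ be a sequence of partitions, $\lambda^{(n)}$ being a partition of $n$, converging uniformly to the limit shape $\gamma\in\Gamma_1$. Then $$W(\lambda^{(n)})=n^{3/2}\iint_{D_\gamma}d_\gamma(x,y)\,dx\,dy+o(n^{3/2})\qquad\text{as }n\to\infty,$$ where $W(\lambda)$ denotes the worst case complexity of the Novelli--Pak--Stoyanovskii algorithm on $\lambda$.
   Context: A partition $\lambda$ of $n$ is a weakly decreasing sequence $\lambda_1\ge\dots\ge\lambda_k>0$ of positive integers with sum $n$; its length is $l(\lambda)=k$, and $\lambda_i=0$ for $i>k$. It is identified with its Young diagram $\{(i,j):1\le i\le l(\lambda),\ 1\le j\le\lambda_i\}$, whose elements are called cells. A cell $(i,j)$ is a corner of $\lambda$ if neither $(i+1,j)$ nor $(i,j+1)$ belongs to $\lambda$. A tableau of shape $\lambda$ is a bijection $T:\lambda\to\{1,\dots,n\}$; the set of tableaux is $\mathrm{T}(\lambda)$. The (column-wise) Novelli--Pak--Stoyanovskii (NPS) algorithm applied to $T\in \mathrm{T}(\lambda)$: order cells by $(i,j)\preceq(i',j')$ if $j<j'$, or $j=j'$ and $i\le i'$. Let $(i_1,j_1)\succ\dots\succ(i_n,j_n)$ be the cells of $\lambda$ in decreasing order, put $k_r=T(i_r,j_r)$ (entries of the initial tableau) and $T_0=T$. For $r=1,\dots,n$ the tableau $T_r$ is obtained from $T_{r-1}$ as follows. Start with the current tableau equal to $T_{r-1}$ and repeat: let $(i,j)$ be the cell of the current tableau containing $k_r$. If $(i,j)$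 is a corner of $\lambda$, stop. Otherwise let $m$ be the minimum of the entries of the current tableau in the cells of $\lambda\cap\{(i+1,j),(i,j+1)\}$. If $k_r<m$, stop. If $m<k_r$, exchange the entries $m$ and $k_r$ (one exchange) and repeat. When stopped, $T_r$ is the current tableau. $n(T)$ is the total number of exchanges performed during the construction of $T_1,\dots,T_n$, and $W(\lambda)=\max_{T\in \mathrm{T}(\lambda)}n(T)$. Scaling. For $n\ge1$ use coordinates $u=\frac{\sqrt n}{\sqrt2}(x+y)$, $v=\frac{\sqrt n}{\sqrt2}(y-x)$ on $\mathbb R^2$. For a partition $\lambda$ of $n$ let $D_\lambda$ be the set of $(x,y)\in\mathbb R^2$ such that either $0<v$ and $0<u\le\lambda_{\lceil v\rceil}$, or $u\ge0$, $v\ge0$, $uv=0$. The boundary function of $\lambda$ is $x\mapsto\sup\{y\in\mathbb R:(x,y)\in D_\lambda\}$. $\Gamma$ is the set of all $1$-Lipschitz functions $\gamma:\mathbb R\to\mathbb R$ for which there is a (bounded) interval $(a,b)$ with $\gamma(x)=|x|$ for all $x\notin(a,b)$. $\Gamma_1$ is the set of $\gamma\in\Gamma$ with $\int_{\mathbb R}(\gamma(x)-|x|)\,dx=1$. With $\gamma_n$ the boundary function of $\lambda^{(n)}$, the sequence $(\lambda^{(n)})$ converges uniformly to $\gamma\in\Gamma_1$ if $\lim_{n\to\infty}\sup_{x\in\mathbb R}|\gamma(x)-\gamma_n(x)|=0$ and there is an interval $(a,b)$ such that $\gamma_n(x)=|x|$ for all $x\notin(a,b)$ and all $n$. For $\gamma\in\Gamma$,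 $D_\gamma=\{(x,y)\in\mathbb R^2:|x|\le y\le\gamma(x)\}$, and for an interior point $(x,y)$ of $D_\gamma$, $$d_\gamma(x,y)=\sqrt2\,\sup\{s+t: s,t>0,\ (x+s-t,\,y+s+t)\in D_\gamma\};$$ $d_\gamma$ is set to $0$ at all other points of $\mathbb R^2$. *)

(* Defs.v *)
From mathcomp Require Import all_boot all_order all_algebra perm.
From mathcomp Require Import all_classical all_reals all_analysis.
Set Implicit Arguments.
Unset Strict Implicit.
Unset Printing Implicit Defensive.
Import Order.TTheory GRing.Theory Num.Theory.
Import numFieldNormedType.Exports.
Local Open Scope ring_scope.

Definition is_partition (n : nat) (lam : seq nat) : bool :=
  [&& sorted geq lam, 0%N \notin lam & sumn lam == n].

(* Rows and columns are numbered from 0, not 1. *)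
Definition cell (lam : seq nat) : finType :=
  {c : 'I_(size lam) * 'I_(head 0%N lam) | (c.2 < nth 0 lam c.1)%N}.

Definition cell_row (lam : seq nat) (c : cell lam) : nat := (val c).1.
Definition cell_col (lam : seq nat) (c : cell lam) : nat := (val c).2.

(* The cells of lam among (i+1, j) and (i, j+1); (i, j) is a corner when there
   are none. *)
Definition succ_cells (lam : seq nat) (c : cell lam) : {set cell lam} :=
  [set d | ((cell_row d == (cell_row c).+1) && (cell_col d == cell_col c))
        || ((cell_row d == cell_row c) && (cell_col d == (cell_col c).+1))].

(* Column-wise order of the cells. *)
Definition cell_le (lam : seq nat) (c d : cell lam) : bool :=
  (cell_col c < cell_col d)%N
  || ((cell_col c == cell_col d) && (cell_row c <= cell_row d)%N).

(* The entry 0 of 'I_n.+1 is not used: a tableau is a bijection onto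
   {1, ..., n}. *)
Definition filling (lam : seq nat) := {ffun cell lam -> 'I_(sumn lam).+1}.

Definition is_tableau (lam : seq nat) (T : filling lam) : bool :=
  injectiveb T
  && (T @: [set: cell lam] == [set k : 'I_(sumn lam).+1 | (0 < k)%N]).

Definition exchange (lam : seq nat) (a b : 'I_(sumn lam).+1) (T : filling lam)
    : filling lam :=
  [ffun c => tperm a b (T c)].

(* One round for the entry k; None means stop. *)
Definition nps_round (lam : seq nat) (k : 'I_(sumn lam).+1) (T : filling lam)
    : option (filling lam) :=
  if [pick c | T c == k] is Some c then
    if [pick d in succ_cells c] is Some d0 then
      let m := T [arg min_(d < d0 in succ_cells c) T d]%N in
      if (m < k)%N then Some (exchange m k T) else None
    else None
  else None.

(* Rounds are repeated until stopping, at most fuel times; the second component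
   counts the exchanges. *)
Fixpoint nps_insert (lam : seq nat) (fuel : nat) (k : 'I_(sumn lam).+1)
    (T : filling lam) : filling lam * nat :=
  if fuel is fuel'.+1 then
    if nps_round k T is Some T' then
      let: (T'', e) := nps_insert fuel' k T' in (T'', e.+1)
    else (T, 0%N)
  else (T, 0%N).

Lemma nps_insert_stops (lam : seq nat) (k : 'I_(sumn lam).+1)
    (T : filling lam) :
  injective T -> nps_round k (nps_insert #|cell lam| k T).1 = None.
Proof.
pose above (c : cell lam) :=
    [set d : cell lam | cell_row c + cell_col c < cell_row d + cell_col d]%N.
suff H fuel (U : filling lam) : injective U ->
    (forall c, U c = k -> #|above c| < fuel)%N ->
    nps_round k (nps_insert fuel k U).1 = None.
  move=> injT; apply: H => // c _; rewrite -cardsT; apply: proper_card.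
  by rewrite properE finset.subsetT;
  apply/subsetPn; exists c; rewrite ?inE ?ltnn.
elim: fuel U => [|fuel IH] U injU Ufuel /=.
  rewrite /nps_round; case: pickP => // c /eqP /Ufuel; by rewrite ltn0.
case E: (nps_round k U) => [U'|] //=.
suff : nps_round k (nps_insert fuel k U').1 = None.
  by case: nps_insert.
move: E; rewrite /nps_round; case: pickP => // c /eqP Uc.
case: pickP => // d0 d0c.
case: arg_minnP => // d dc _; case: ifP => // _ [<-].
apply: IH => [x y|c'].
  by rewrite !ffunE => /perm_inj /injU.
rewrite ffunE => Uc'.
have -> : c' = d.
  by apply: injU; apply: (@perm_inj _ (tperm (U d) k)); rewrite Uc' tpermL.
have lt_cd : (cell_row c + cell_col c < cell_row d + cell_col d)%N.
  move: dc; rewrite inE => /orP[] /andP[/eqP-> /eqP->].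
    by rewrite addSn.
  by rewrite addnS.
rewrite -ltnS; apply: leq_trans (Ufuel c Uc).
rewrite ltnS; apply: proper_card; rewrite properE; apply/andP; split.
  by apply/fintype.subsetP => e; rewrite !inE; apply: ltn_trans.
by apply/subsetPn; exists d; rewrite !inE ?ltnn.
Qed.

(* Every exchange moves k to a cell with larger row + column, so #|cell lam|
   rounds are enough to reach the stopping condition (nps_insert_stops). *)
Definition nps (lam : seq nat) (T : filling lam) : filling lam * nat :=
  foldl (fun Se c =>
           let: (S', e') := nps_insert #|cell lam| (T c) Se.1 in
           (S', (Se.2 + e')%N))
        (T, 0%N) (sort (fun c d => cell_le d c) (enum (cell lam))).

Definition nps_exchanges (lam : seq nat) (T : filling lam) : nat := (nps T).2.

Definition worst_case (lam : seq nat) : nat :=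
  \max_(T : filling lam | is_tableau T) nps_exchanges T.

Local Open Scope classical_set_scope.

(* The part of index ceil v, counted from 1, is nth 0 lam (ceil v - 1). *)
Definition scaled_diagram (R : realType) (lam : seq nat) : set (R * R) :=
  [set z | let u := Num.sqrt (sumn lam)%:R / Num.sqrt 2 * (z.1 + z.2) in
           let v := Num.sqrt (sumn lam)%:R / Num.sqrt 2 * (z.2 - z.1) in
           (0 < v /\ 0 < u <= (nth 0%N lam `|Num.ceil v|.-1)%:R)
           \/ [/\ 0 <= u, 0 <= v & u * v = 0]].

Definition boundary (R : realType) (lam : seq nat) (x : R) : R :=
  sup [set y | scaled_diagram lam (x, y)].

Definition Gamma (R : realType) : set (R -> R) :=
  [set gamma | 1.-lipschitz gamma /\
     exists a b : R, forall x, x \notin `]a, b[ -> gamma x = `|x|].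

Definition Gamma1 (R : realType) : set (R -> R) :=
  [set gamma | Gamma gamma /\
     \int[lebesgue_measure]_x (gamma x - `|x|) = 1].

Definition converges_uniformly (R : realType) (lam : nat -> seq nat)
    (gamma : R -> R) : Prop :=
  (ereal_sup [set (`|gamma x - boundary (lam n) x|)%:E | x in [set: R]]
     @[n --> \oo] --> 0%E) /\
  exists a b : R, forall n x, (0 < n)%N -> x \notin `]a, b[ ->
    boundary (lam n) x = `|x|.

Definition region (R : realType) (gamma : R -> R) : set (R * R) :=
  [set z | `|z.1| <= z.2 <= gamma z.1].

Definition dist_gamma (R : realType) (gamma : R -> R) (z : R * R) : R :=
  if `[< (region gamma)° z >] then
    Num.sqrt 2 * sup [set r | exists s t : R,
      [/\ 0 < s, 0 < t, region gamma (z.1 + s - t, z.2 + s + t) & r = s + t]]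
  else 0.

(* Main.v *)
(** The insertion of the entry of a cell [c] performs at most [max_deg c - cell_deg c]
    exchanges, where [max_deg c] is the largest value of row + column over the cells weakly
    below and to the right of [c].  A tableau in which the entries decrease with [max_deg],
    and along the column-wise order inside a class of equal [max_deg], attains this bound in
    every insertion, so the worst case is exactly the sum of these differences.

    In the rescaled coordinates a cell is a square of area [1 / n], and the sum divided by
    [n^(3/2)] is the integral of a step function, which equals [dist_gamma] for the discrete
    boundary up to [2 / sqrt n].  When the boundary is within [e] of [gamma], the step
    function shifted down (up) by [2 e] is dominated by (dominates) [dist_gamma], except on
    a strip of width [2 e] along the graph of the absolute value. *)
Require Import Defs.
From mathcomp Require Import all_boot all_order all_algebra perm.
From mathcomp Require Import all_classical all_reals all_analysis measurable_realfun.
From mathcomp Require Import ring lra zify.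
Set Implicit Arguments.
Unset Strict Implicit.
Unset Printing Implicit Defensive.
Import Order.TTheory GRing.Theory Num.Theory.
Import numFieldNormedType.Exports.
Local Open Scope ring_scope.

(** * Upper bound for the exchanges of each insertion *)

Section InsertionBounds.

Variable lam : seq nat.
Implicit Types (c d e : cell lam) (T U : filling lam).
Local Open Scope nat_scope.

Definition cell_deg c := cell_row c + cell_col c.

Definition cell_below c d : bool :=
  (cell_row c <= cell_row d) && (cell_col c <= cell_col d).

Definition max_deg c : nat := \max_(d | cell_below c d) cell_deg d.

Lemma cell_below_refl c : cell_below c c.
Proof. by rewrite /cell_below !leqnn. Qed.

Lemma cell_below_trans c d e : cell_below c d -> cell_below d e -> cell_below c e.
Proof.
by move=> /andP[a b] /andP[a' b']; rewrite /cell_below (leq_trans a a') (leq_trans b b').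
Qed.

Lemma cell_inj c d : cell_row c = cell_row d -> cell_col c = cell_col d -> c = d.
Proof.
move: c d => [[i j] p] [[i' j'] p']; rewrite /cell_row /cell_col /= => /val_inj hi /val_inj hj.
by apply: val_inj => /=; rewrite hi hj.
Qed.

Lemma succ_cell_below c d : d \in succ_cells c -> cell_below c d.
Proof. by rewrite inE /cell_below => /orP[]/andP[/eqP-> /eqP->]; rewrite !leqnn leqnSn. Qed.

Lemma succ_cell_deg c d : d \in succ_cells c -> cell_deg d = (cell_deg c).+1.
Proof. by rewrite inE /cell_deg => /orP[]/andP[/eqP-> /eqP->]; rewrite ?addSn ?addnS. Qed.

Lemma cell_deg_le_max c d : cell_below c d -> cell_deg d <= max_deg c.
Proof. by move=> cd; rewrite /max_deg (bigD1 d) //= leq_maxl. Qed.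

Lemma max_deg_attained c : {d | cell_below c d & cell_deg d = max_deg c}.
Proof.
have c0 : 0 < #|[pred d | cell_below c d]|.
  by apply/card_gt0P; exists c; rewrite inE cell_below_refl.
have [d dc md] := eq_bigmax_cond cell_deg c0.
by exists d => //; rewrite -md /max_deg; apply: eq_bigl => e; rewrite inE.
Qed.

Lemma max_deg_below c d : cell_below c d -> max_deg d <= max_deg c.
Proof.
move=> cd; case: (max_deg_attained d) => e de <-.
exact/cell_deg_le_max/(cell_below_trans cd).
Qed.

Lemma cell_below_le c d : cell_below c d -> cell_le c d.
Proof. by rewrite /cell_below /cell_le => /andP[r]; rewrite leq_eqVlt r andbT orbC. Qed.

Lemma cell_le_trans : transitive (@cell_le lam).
Proof. move=> c d e; rewrite /cell_le; lia. Qed.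

Lemma cell_le_anti : antisymmetric (@cell_le lam).
Proof. by move=> c d; rewrite /cell_le => h; apply: cell_inj; lia. Qed.

Lemma cell_le_total : total (@cell_le lam).
Proof. move=> c d; rewrite /cell_le; lia. Qed.

Lemma nps_roundP k U U' : injective U -> nps_round k U = Some U' ->
  exists x y, [/\ U x = k, y \in succ_cells x, U y < k,
    (forall z, z \in succ_cells x -> U y <= U z) & U' = exchange (U y) k U].
Proof.
move=> injU; rewrite /nps_round; case: pickP => // x /eqP Ux.
case: pickP => // d0 hd0; case: arg_minnP => // d hd hmin.
case: ifP => // hlt [<-]; exists x, d; split=> //.
Qed.

Lemma exchange_inj k m U : injective U -> injective (exchange k m U).
Proof. by move=> injU x y; rewrite !ffunE => /perm_inj/injU. Qed.

Lemma exchange_at x y U (injU : injective U) z :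
  exchange (U y) (U x) U z = if z == x then U y else if z == y then U x else U z.
Proof.
rewrite ffunE; case: eqP => [->|nx]; first by rewrite tpermR.
case: eqP => [->|ny]; first by rewrite tpermL.
by rewrite tpermD //; apply/eqP => /injU/esym.
Qed.

(** Each exchange moves [k] to a successor cell, whose degree is larger by one, so the exchanges are
    counted by the degrees of the end cells. Only cells weakly below and to the right of [x] are
    touched, which keeps the entries still to be inserted at their initial places. *)
Lemma nps_insertP fuel k U x : injective U -> U x = k ->
  exists y, [/\ injective (nps_insert fuel k U).1,
    (nps_insert fuel k U).1 y = k, cell_below x y,
    cell_deg y = cell_deg x + (nps_insert fuel k U).2 &
    forall d, ~~ cell_below x d -> (nps_insert fuel k U).1 d = U d].
Proof.
elim: fuel U x => [|fuel IH] U x injU Ux /=.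
  by exists x; rewrite addn0 cell_below_refl.
case E: nps_round => [U'|] /=; last by exists x; rewrite addn0 cell_below_refl.
have [x' [y [Ux' yx _ _ EU']]] := nps_roundP injU E.
have ? : x' = x by apply: injU; rewrite Ux. subst x'.
have injU' : injective U' by rewrite EU'; exact: exchange_inj.
have yx0 : y != x by apply/eqP => eyx; have := succ_cell_deg yx; rewrite eyx; lia.
have U'y : U' y = k by rewrite EU' -Ux exchange_at // (negPf yx0) eqxx.
have [z [i1 i2 yz dz fr]] := IH _ _ injU' U'y.
exists z; case: nps_insert i1 i2 dz fr => [V e] /= i1 i2 dz fr.
split=> //; first exact: cell_below_trans (succ_cell_below yx) yz.
  by rewrite dz (succ_cell_deg yx) addSnnS.
move=> d nd; rewrite fr; last first.
  by apply: contra nd; apply: cell_below_trans (succ_cell_below yx).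
rewrite EU' -Ux exchange_at //; case: eqP nd => [->|_]; first by rewrite cell_below_refl.
by case: eqP => // ->; rewrite succ_cell_below.
Qed.

Definition nps_step T (Se : filling lam * nat) c :=
  let: (S', e') := nps_insert #|cell lam| (T c) Se.1 in (S', Se.2 + e').

Lemma nps_stepE T Se c : nps_step T Se c =
  ((nps_insert #|cell lam| (T c) Se.1).1, Se.2 + (nps_insert #|cell lam| (T c) Se.1).2).
Proof. by rewrite /nps_step; case: nps_insert. Qed.

Lemma npsE T : nps T =
  foldl (nps_step T) (T, 0) (sort (fun c d => cell_le d c) (enum (cell lam))).
Proof. by []. Qed.

Definition cell_ge c d := cell_le d c.

Lemma cell_ge_trans : transitive cell_ge.
Proof. by move=> c d e dc ce; apply: cell_le_trans ce dc. Qed.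

(** A cell weakly below and to the right of [c] comes after [c] in the column-wise order, while the
    cells still to be processed come before it. *)
Lemma sorted_tail_not_below c s :
  sorted cell_ge (c :: s) -> uniq (c :: s) ->
  forall d, d \in s -> ~~ cell_below c d.
Proof.
move=> /= srt /andP[cs _] d ds; apply/negP => /cell_below_le cd.
have dc : cell_ge c d by have /allP := order_path_min cell_ge_trans srt; apply.
by move: cs; rewrite (cell_le_anti (x:=c) (y:=d)) ?ds // cd.
Qed.

(** The invariant is that the current tableau [U] agrees with the initial [T] on the unprocessed
    cells [s]; hence the entry [T c] starts its insertion at [c]. *)
Lemma nps_fold_le T s U a : injective U -> sorted cell_ge s -> uniq s ->
  {in s, forall c, U c = T c} ->
  (foldl (nps_step T) (U, a) s).2 <= a + \sum_(c <- s) (max_deg c - cell_deg c).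
Proof.
elim: s U a => [|c s IH] U a injU srt us Us; first by rewrite big_nil addn0.
rewrite big_cons [foldl _ _ _]/= nps_stepE /= addnA.
have [y [injV _ cy dy fr]] := nps_insertP #|cell lam| injU (Us c (mem_head _ _)).
apply: leq_trans (IH _ _ injV (path_sorted srt) _ _) _.
- by case/andP: us.
- move=> d ds; rewrite fr ?Us ?inE ?ds ?orbT //.
  exact: (sorted_tail_not_below srt us).
- rewrite leq_add2r leq_add2l.
  by have := cell_deg_le_max cy; rewrite dy /=; case: nps_insert => V e /=; lia.
Qed.

Lemma sort_cells :
  let s := sort cell_ge (enum (cell lam)) in
  [/\ sorted cell_ge s, uniq s & perm_eq s (enum (cell lam))].
Proof.
split; rewrite ?sort_uniq ?enum_uniq ?perm_sort ?perm_refl //.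
by apply: sort_sorted => c d; apply: cell_le_total.
Qed.

Lemma sum_sort_cells (F : cell lam -> nat) :
  \sum_(c <- sort cell_ge (enum (cell lam))) F c = \sum_c F c.
Proof. by have [_ _ p] := sort_cells; rewrite (perm_big _ p) /= big_enum. Qed.

Lemma nps_exchanges_le T : injective T ->
  nps_exchanges T <= \sum_c (max_deg c - cell_deg c).
Proof.
move=> injT; rewrite /nps_exchanges npsE -sum_sort_cells.
by have [srt us _] := sort_cells; apply: nps_fold_le.
Qed.

End InsertionBounds.

(** * A tableau that attains the bound in every insertion *)

Section ExtremalTableau.

Variable lam : seq nat.
Implicit Types (c d e : cell lam) (T U : filling lam).
Local Open Scope nat_scope.

Lemma part_antitone i j : sorted geq lam -> i <= j -> nth 0 lam j <= nth 0 lam i.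
Proof.
move=> srt ij; case: (ltnP j (size lam)) => [js|js]; last by rewrite nth_default.
have geqT : transitive geq by move=> a b c ba ac; exact: leq_trans ac ba.
have geqR : reflexive geq by move=> a; exact: leqnn.
exact: (sorted_leq_nth geqT geqR 0 srt i j (leq_ltn_trans ij js) js ij).
Qed.

Lemma card_cell : sorted geq lam -> #|cell lam| = sumn lam.
Proof.
move=> srt; rewrite card_sig -sum1_card.
rewrite -(pair_big_dep xpredT (fun (i : 'I_(size lam)) (j : 'I_(head 0 lam)) =>
  j < nth 0 lam i) (fun _ _ => 1)) /=.
rewrite sumnE (big_nth 0) big_mkord; apply: eq_bigr => i _.
have le : nth 0 lam i <= head 0 lam by rewrite -nth0 part_antitone.
rewrite -(big_ord_widen_cond _ xpredT (fun _ => 1) le) sum1_card card_ord //.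
Qed.

(* Entries increase as [max_deg] decreases; within a class of equal [max_deg]
   they decrease along the column-wise order. *)
Definition extremal_lt c d : bool :=
  (max_deg d < max_deg c) || ((max_deg c == max_deg d) && cell_le d c && (c != d)).

Lemma extremal_lt_trans : transitive extremal_lt.
Proof.
move=> d c e; rewrite /extremal_lt.
case/orP => [cd|/andP[/andP[/eqP cd dc] ncd]]; case/orP => [de|/andP[/andP[/eqP de ed] nde]].
- by rewrite (ltn_trans de cd).
- by rewrite -de cd.
- by rewrite cd de.
rewrite cd de eqxx (cell_le_trans ed dc) /=; apply/orP; right.
by apply: contra nde => /eqP ce; subst e; apply/eqP/cell_le_anti; rewrite ed dc.
Qed.

Lemma extremal_lt_irr c : extremal_lt c c = false.
Proof. by rewrite /extremal_lt ltnn !eqxx andbF. Qed.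

Lemma extremal_lt_total c d : c != d -> extremal_lt c d || extremal_lt d c.
Proof.
rewrite /extremal_lt => ncd.
by case: (ltngtP (max_deg d) (max_deg c)) => //= _; rewrite ncd eq_sym ncd !andbT cell_le_total.
Qed.

Definition extremal_rank c := #|[set d | extremal_lt d c]|.

Lemma extremal_rank_lt c d : extremal_lt c d -> extremal_rank c < extremal_rank d.
Proof.
move=> cd; apply: proper_card; apply/properP; split.
  by apply/fintype.subsetP => e; rewrite !inE => /extremal_lt_trans; apply.
by exists c; rewrite inE ?cd ?extremal_lt_irr.
Qed.

Lemma extremal_rank_lt_card c : extremal_rank c < #|cell lam|.
Proof.
rewrite -cardsT; apply: proper_card; apply/properP; split; first exact: finset.subsetT.
by exists c; rewrite ?inE ?extremal_lt_irr.
Qed.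

Hypothesis lam_sorted : sorted geq lam.

Definition extremal_tableau : filling lam := [ffun c => inord (extremal_rank c).+1].

Lemma extremal_tableauE c : extremal_tableau c = (extremal_rank c).+1 :> nat.
Proof.
by rewrite ffunE inordK // !ltnS -card_cell // extremal_rank_lt_card.
Qed.

Lemma extremal_tableau_lt c d :
  extremal_lt c d -> extremal_tableau c < extremal_tableau d.
Proof. by move=> cd; rewrite !extremal_tableauE ltnS extremal_rank_lt. Qed.

Lemma extremal_tableau_inj : injective extremal_tableau.
Proof.
move=> c d cd; apply/eqP/negPn/negP => ncd.
by case/orP: (extremal_lt_total ncd) => /extremal_tableau_lt; rewrite cd ltnn.
Qed.

Lemma extremal_is_tableau : is_tableau extremal_tableau.
Proof.
apply/andP; split; first exact/injectiveP/extremal_tableau_inj.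
rewrite eqEcard; apply/andP; split.
  by apply/fintype.subsetP => k /imsetP[c _ ->]; rewrite inE extremal_tableauE.
rewrite (card_imset _ extremal_tableau_inj) cardsT card_cell //.
rewrite (_ : [set k | _] = [set~ ord0]); last first.
  by apply/setP => k; rewrite !inE -val_eqE /= lt0n.
by rewrite cardsC1 card_ord.
Qed.

(** A class consists of the cells with a given [max_deg]. This is the part of the extremal order
    that survives the whole run, because all exchanges take place inside a class. *)
Definition class_sorted U := forall d e, max_deg e < max_deg d -> U d < U e.

(** Here [c] is the cell where an insertion starts and [x] the current place of its entry. For an
    unprocessed cell the property is used with [x] equal to [c]. *)
Definition tops_class c U (x : cell lam) :=
  forall d, cell_le c d -> d != x -> max_deg d = max_deg c -> U d < U x.

Lemma exchange_class_sorted U (x y : cell lam) : injective U -> max_deg x = max_deg y ->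
  class_sorted U -> class_sorted (exchange (U y) (U x) U).
Proof.
move=> injU xy cs.
have ex z : exists2 w, exchange (U y) (U x) U z = U w & max_deg w = max_deg z.
  rewrite exchange_at //; case: eqP => [->|_]; first by exists y.
  by case: eqP => [->|_]; [exists x | exists z].
move=> d e; have [d' -> <-] := ex d; have [e' -> <-] := ex e; exact: cs.
Qed.

(** The exchanged cells both follow [e], share a class and differ from [z], so either both of their
    entries are compared with that of [z] or neither is. *)
Lemma exchange_tops_class U (x y : cell lam) e (z : cell lam) :
  injective U -> cell_le e x -> cell_le e y ->
  max_deg x = max_deg y -> z != x -> z != y -> tops_class e U z ->
  tops_class e (exchange (U y) (U x) U) z.
Proof.
move=> injU ex ey xy zx zy te d ed dz me; rewrite !exchange_at //.
rewrite (negPf zx) (negPf zy).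
case: eqP => [dx|_]; first by subst d; apply: te; rewrite // 1?eq_sym -?xy.
by case: eqP => [dy|_]; [subst d; apply: te; rewrite // 1?eq_sym ?xy | apply: te].
Qed.

(** Let [z] attain [max_deg x]. As [x] has smaller degree, one step down or to the right stays
    weakly above and to the left of [z], and [z] still bounds the maximum from below. *)
Lemma succ_same_max (x : cell lam) : cell_deg x < max_deg x ->
  exists2 y, y \in succ_cells x & max_deg y = max_deg x.
Proof.
move=> dx; have [z xz dz] := max_deg_attained x.
suff [y yx yz] : exists2 y, y \in succ_cells x & cell_below y z.
  exists y => //; apply/eqP; rewrite eqn_leq max_deg_below ?succ_cell_below //=.
  by rewrite -dz cell_deg_le_max.
have /andP[rxz cxz] := xz.
have zP : cell_col z < nth 0 lam (cell_row z) := valP z.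
(* The parts decrease, so every position above and to the left of [z] is a cell. *)
have mk (i j : nat) : i <= cell_row z -> j <= cell_col z ->
    exists y : cell lam, cell_row y = i /\ cell_col y = j.
  move=> iz jz.
  have hi : i < size lam := leq_ltn_trans iz (ltn_ord (val z).1).
  have hj : j < head 0 lam := leq_ltn_trans jz (ltn_ord (val z).2).
  have p : (Ordinal hi, Ordinal hj).2 < nth 0 lam (Ordinal hi, Ordinal hj).1.
    exact: leq_ltn_trans jz (leq_trans zP (part_antitone lam_sorted iz)).
  by exists (exist _ (Ordinal hi, Ordinal hj) p).
have [lt|ge] := ltnP (cell_row x) (cell_row z).
  have [y [yr yc]] := mk _ _ lt cxz.
  by exists y; rewrite ?inE /cell_below yr yc ?eqxx // lt.
have lt : cell_col x < cell_col z.
  by move: dx; rewrite -dz /cell_deg; lia.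
have [y [yr yc]] := mk _ _ rxz lt.
by exists y; rewrite ?inE /cell_below yr yc ?eqxx ?orbT // rxz.
Qed.

(** Some successor of [x] is in the same class and has a smaller entry by [tops_class], so the round
    does not stop. A successor outside the class has smaller [max_deg], hence a larger entry by
    [class_sorted], so the minimum is found inside the class. *)
Lemma nps_round_extremal U c (x : cell lam) : injective U -> class_sorted U ->
  cell_below c x -> max_deg x = max_deg c -> tops_class c U x ->
  cell_deg x < max_deg x ->
  exists y, [/\ y \in succ_cells x, max_deg y = max_deg x &
    nps_round (U x) U = Some (exchange (U y) (U x) U)].
Proof.
move=> injU csU cx mx tx dx; have [y0 y0x my0] := succ_same_max dx.
have lt0 : U y0 < U x.
  apply: tx; rewrite ?my0 //.
    exact/cell_below_le/(cell_below_trans cx)/succ_cell_below.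
  by apply/eqP => eyx; have := succ_cell_deg y0x; rewrite eyx; lia.
rewrite /nps_round; case: pickP => [x' /eqP/injU ->|/(_ x)]; last by rewrite eqxx.
case: pickP => [d0 d0x|/(_ y0)]; last by rewrite y0x.
case: arg_minnP => // d dsucc dmin; exists d; split=> //.
  apply/eqP; rewrite eqn_leq max_deg_below ?succ_cell_below //= leqNgt -my0.
  by apply/negP => /(csU y0 d); rewrite ltnNge dmin.
by rewrite (leq_ltn_trans (dmin _ y0x) lt0).
Qed.

(** [P] stands for the unprocessed cells, which precede [c]. Both invariants persist, and by
    [nps_round_extremal] the insertion can stop only where the degree equals the maximum of the
    class. *)
Lemma nps_insert_extremal fuel U k c (x : cell lam) (P : pred (cell lam)) :
  injective U -> U x = k -> class_sorted U -> cell_below c x ->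
  max_deg x = max_deg c -> tops_class c U x ->
  (forall e, P e -> ~~ cell_le c e /\ cell_le e c) ->
  (forall e, P e -> tops_class e U e) ->
  nps_round k (nps_insert fuel k U).1 = None ->
  [/\ class_sorted (nps_insert fuel k U).1,
      (forall e, P e -> tops_class e (nps_insert fuel k U).1 e) &
      cell_deg x + (nps_insert fuel k U).2 = max_deg c].
Proof.
move=> injU Ux csU cx mx tx Pc PU.
elim: fuel U x injU Ux csU cx mx tx PU => [|fuel IH] U x injU Ux csU cx mx tx PU /=;
  have stop : nps_round k U = None -> cell_deg x = max_deg c
    by move=> stop; apply/eqP; rewrite -mx eqn_leq cell_deg_le_max ?cell_below_refl //=;
       rewrite leqNgt; apply/negP => /(nps_round_extremal injU csU cx mx tx)[y [_ _]];
       rewrite Ux stop.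
  by move=> /stop ->; split=> //; rewrite addn0.
case E: (nps_round k U) => [U'|] /=; last by move=> _; rewrite addn0 (stop E); split.
have [x' [y [Ux' yx _ _ _]]] := nps_roundP injU E.
have ? : x' = x by apply: injU; rewrite Ux. subst x'.
have lt : cell_deg x < max_deg x.
  by rewrite -(succ_cell_deg yx) (cell_deg_le_max (succ_cell_below yx)).
have [z [zx mz]] := nps_round_extremal injU csU cx mx tx lt.
rewrite Ux E => -[EU'].
have cz := cell_below_trans cx (succ_cell_below zx).
have zNx : z != x by apply/eqP => ezx; have := succ_cell_deg zx; rewrite ezx; lia.
have injU' : injective U' by rewrite EU'; exact: exchange_inj.
have U'z : U' z = k by rewrite EU' -Ux exchange_at // (negPf zNx) eqxx.
have csU' : class_sorted U' by rewrite EU' -Ux; exact: exchange_class_sorted.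
have tz : tops_class c U' z.
  move=> d cd dz md; rewrite U'z EU' -Ux exchange_at // (negPf dz).
  case: eqP => [_|/eqP dx]; last exact: tx.
  by apply: tx => //; [exact: cell_below_le | rewrite mz].
have PU' e : P e -> tops_class e U' e.
  move=> Pe; have [nce ec] := Pc _ Pe; rewrite EU' -Ux.
  have neq w : cell_below c w -> e != w.
    by move=> cw; apply: contraNneq nce => ->; exact: cell_below_le.
  have below w : cell_below c w -> cell_le e w.
    by move=> cw; apply: cell_le_trans ec (cell_below_le cw).
  by apply: exchange_tops_class; rewrite ?neq ?below //; exact: PU.
case: nps_insert (IH _ _ injU' U'z csU' cz (etrans mz mx) tz PU') => V e /= IH' /IH' [h1 h2 h3].
by split=> //; rewrite -h3 (succ_cell_deg zx) addSnnS.
Qed.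

Lemma nps_fold_extremal T s U a : injective U -> sorted (@cell_ge lam) s -> uniq s ->
  {in s, forall c, U c = T c} -> class_sorted U ->
  {in s, forall c, tops_class c U c} ->
  (foldl (nps_step T) (U, a) s).2 = a + \sum_(c <- s) (max_deg c - cell_deg c).
Proof.
elim: s U a => [|c s IH] U a injU srt us Us csU tU; first by rewrite big_nil addn0.
rewrite big_cons [foldl _ _ _]/= nps_stepE /= addnA.
have Uc := Us c (mem_head _ _).
have [y [injV _ cy dy fr]] := nps_insertP #|cell lam| injU Uc.
have sc e : e \in s -> ~~ cell_le c e /\ cell_le e c.
  move=> es; have ec : cell_ge c e.
    by have /allP := order_path_min (@cell_ge_trans lam) srt; apply.
  split=> //; apply/negP => ce; case/andP: us => /negP[].
  by rewrite (cell_le_anti (x := c) (y := e)) ?es //; apply/andP; split.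
have [csV tV <-] := nps_insert_extremal (P := mem s) injU Uc csU (cell_below_refl c)
  erefl (tU c (mem_head _ _)) sc (fun e es => tU e (mem_behead (s := c :: s) es))
  (nps_insert_stops (T c) injU).
rewrite addKn IH //.
- exact: path_sorted srt.
- by case/andP: us.
- move=> d ds; rewrite fr ?Us ?inE ?ds ?orbT //.
  exact: (sorted_tail_not_below srt us).
Qed.

Lemma nps_exchanges_extremal :
  nps_exchanges extremal_tableau = \sum_(c : cell lam) (max_deg c - cell_deg c).
Proof.
rewrite /nps_exchanges npsE -sum_sort_cells.
have [srt us _] := sort_cells lam; apply: nps_fold_extremal => //.
- exact: extremal_tableau_inj.
- by move=> d e de; apply: extremal_tableau_lt; rewrite /extremal_lt de.
- move=> c _ d cd dc md; apply: extremal_tableau_lt.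
  by rewrite /extremal_lt md eqxx cd dc orbT.
Qed.

(* The bound [max_deg c - cell_deg c] on the exchanges of a single insertion is
   attained by all the cells of the extremal tableau simultaneously. *)
Lemma worst_caseE : worst_case lam = \sum_(c : cell lam) (max_deg c - cell_deg c).
Proof.
apply/eqP; rewrite eqn_leq; apply/andP; split.
  by apply/bigmax_leqP => T /andP[/injectiveP injT _]; exact: nps_exchanges_le.
rewrite -nps_exchanges_extremal /worst_case.
exact: (@leq_bigmax_cond _ (@is_tableau lam) (@nps_exchanges lam) _ extremal_is_tableau).
Qed.

End ExtremalTableau.

(** * Areas of rotated squares and of strips along the graph of the absolute value *)

Section PlaneSets.

Variable R : realType.
Local Open Scope classical_set_scope.
Local Notation mu := (@lebesgue_measure R).
Local Notation mu2 := (mu \x mu)%E.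
Implicit Types (A B d p q M : R).

(** A square with sides along the diagonals, half-open so that the squares of distinct cells are
    disjoint. *)
Definition diamond A B d : set (R * R) :=
  [set z | [/\ A < z.2 - z.1, z.2 - z.1 <= A + d,
               B < z.1 + z.2 & z.1 + z.2 <= B + d]].

Definition cone_strip M p q : set (R * R) :=
  [set z | [/\ `|z.1| <= M, `|z.1| + p <= z.2 & z.2 <= `|z.1| + q]].

Lemma measurable_setP (P : pred (R * R)) :
  measurable_fun [set: R * R] P -> measurable [set z | P z].
Proof.
move=> mP; have := mP measurableT [set true] I.
by rewrite setTI; congr measurable; apply/seteqP; split.
Qed.

Lemma measurable_diamond A B d : measurable (diamond A B d).
Proof.
rewrite (_ : diamond A B d = [set z | [&& A < z.2 - z.1, z.2 - z.1 <= A + d,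
  B < z.1 + z.2 & z.1 + z.2 <= B + d]]).
  apply: measurable_setP; repeat apply: measurable_and.
  - by apply: measurable_fun_ltr => //; apply: measurable_funB.
  - by apply: measurable_fun_ler => //; apply: measurable_funB.
  - by apply: measurable_fun_ltr => //; apply: measurable_funD.
  - by apply: measurable_fun_ler => //; apply: measurable_funD.
by apply/seteqP; split => z /= /and4P.
Qed.

Lemma measurable_cone_strip M p q : measurable (cone_strip M p q).
Proof.
have mn : measurable_fun [set: R * R] (fun z : R * R => `|z.1|).
  exact: measurableT_comp.
rewrite (_ : cone_strip M p q = [set z | [&& `|z.1| <= M, `|z.1| + p <= z.2 &
  z.2 <= `|z.1| + q]]).
  apply: measurable_setP; repeat apply: measurable_and.
  - exact: measurable_fun_ler.
  - by apply: measurable_fun_ler => //; apply: measurable_funD.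
  - by apply: measurable_fun_ler => //; apply: measurable_funD.
by apply/seteqP; split => z /= /and3P.
Qed.

Lemma cone_strip_measure M p q : 0 <= M -> p < q ->
  mu2 (cone_strip M p q) = ((q - p) * (M + M))%:E.
Proof.
move=> M0 pq; rewrite /product_measure1 /=.
transitivity (\int[mu]_x ((q - p)%:E * (\1_(`[- M, M] : set R) x)%:E)%E)%E.
  apply: eq_integral => x _; rewrite /= indicE.
  have xE : (x \in (`[- M, M] : set R)) = (`|x| <= M).
    by rewrite ler_norml; apply/idP/idP; rewrite inE /= in_itv.
  rewrite xE; case: (boolP (`|x| <= M)) => xM /=.
    rewrite mulr1n mule1.
    rewrite (_ : xsection (cone_strip M p q) x = `[`|x| + p, `|x| + q]%classic); last first.
      apply/seteqP; split => y /=; rewrite /xsection /= in_itv /= inE /=.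
        by case=> _ -> ->.
      by case/andP.
    rewrite lebesgue_measure_itv /= lte_fin ltrD2l pq -EFinB; congr (_%:E); ring.
  rewrite mulr0n mule0 (_ : xsection (cone_strip M p q) x = set0) ?measure0 //.
  apply/seteqP; split => y //=; rewrite /xsection /= inE /= => -[].
  by rewrite (negPf xM).
rewrite ge0_integralZl //; last first.
  by rewrite lee_fin subr_ge0 ltW.
  by apply/measurable_EFinP; apply: measurable_indic.
rewrite integral_indic // setIT /= lebesgue_measure_itv /= lte_fin.
case: ltP => h; first by rewrite -EFinB -EFinM opprK.
have -> : M = 0 by lra.
by rewrite mule0 addr0 mulr0.
Qed.

Lemma integral_affine (k c s t : R) : s < t ->
  (\int[mu]_(x in `[s, t]) (k + c * x)%:E =
   (k * (t - s) + c / 2 * (t ^+ 2 - s ^+ 2))%:E)%E.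
Proof.
move=> st; pose F := fun x : R => k * x + c / 2 * x ^+ 2.
have dF (x : R) : is_derive x (1 : R) F (k + c * x).
  rewrite /F; apply: is_derive_eq; rewrite /GRing.scale /=; by field.
have cF : continuous F.
  by move=> x; apply: differentiable_continuous; apply/derivable1_diffP; have [] := dF x.
rewrite (@continuous_FTC2 _ (fun x => k + c * x) F) //.
- by rewrite -EFinB /F; congr (_%:E); ring.
- apply: continuous_subspaceT => x.
  by apply: cvgD; [exact: cvg_cst | apply: cvgM; [exact: cvg_cst | exact: cvg_id]].
- split; first by move=> x _; have [] := dF x.
    by apply: cvg_at_right_filter; exact: cF.
  by apply: cvg_at_left_filter; exact: cF.
- by move=> x _; rewrite derive1E (@derive_val _ _ _ _ _ _ _ (dF x)).
Qed.

(** With [w = B - A], this is the length of the vertical section of [diamond A B d] at abscissa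
    [x]. *)
Definition tent (w d x : R) : R := Num.max 0 (d - `|2 * x - w|).

Lemma measurable_tent w d : measurable_fun setT (tent w d).
Proof.
apply: measurable_maxr => //; apply: measurable_funB => //.
by apply: measurableT_comp => //; apply: measurable_funB => //; apply: measurable_funM.
Qed.

Lemma integral_tent (w d : R) : 0 < d ->
  (\int[mu]_x (tent w d x)%:E = (d ^+ 2 / 2)%:E)%E.
Proof.
move=> d0; pose a := (w - d) / 2; pose m := w / 2; pose b := (w + d) / 2.
have am : a < m by rewrite /a /m; lra.
have mb : m < b by rewrite /b /m; lra.
have -> : (\int[mu]_x (tent w d x)%:E = \int[mu]_(x in `[a, b]) (tent w d x)%:E)%E.
  rewrite [RHS]integral_mkcond; apply: eq_integral => x _.
  rewrite patchE; case: ifPn => //; rewrite notin_setE /= in_itv /= => /negP.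
  rewrite negb_and -!ltNge /tent /a /b => h.
  suff : d - `|2 * x - w| <= 0 by move=> /max_idPl ->.
  case/orP: h => h; [rewrite ltr0_norm|rewrite gtr0_norm]; lra.
have mt (D : set R) : measurable_fun D (EFin \o tent w d).
  by apply/measurable_EFinP; apply: (@measurable_funS _ _ _ _ setT) => //; exact: measurable_tent.
have -> : `[a, b]%classic = `[a, m]%classic `|` `]m, b]%classic :> set R.
  by rewrite -itv_bndbnd_setU // bnd_simp ltW.
rewrite ge0_integral_setU //=.
- rewrite integral_itv_obnd_cbnd; last exact: mt.
  have -> : (\int[mu]_(x in `[a, m]) (tent w d x)%:E =
             \int[mu]_(x in `[a, m]) (d - w + 2 * x)%:E)%E.
    apply: eq_integral => x; rewrite inE /= in_itv /= /a /m /tent => /andP[h1 h2].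
    by rewrite ler0_norm ?(max_idPr _); [congr (_%:E)| |]; lra.
  have -> : (\int[mu]_(x in `[m, b]) (tent w d x)%:E =
             \int[mu]_(x in `[m, b]) (d + w + (- 2) * x)%:E)%E.
    apply: eq_integral => x; rewrite inE /= in_itv /= /b /m /tent => /andP[h1 h2].
    by rewrite ger0_norm ?(max_idPr _); [congr (_%:E)| |]; lra.
  rewrite !integral_affine // -EFinD; congr (_%:E); rewrite /a /m /b; by field.
- exact: mt.
- by move=> x _; rewrite lee_fin le_max lexx.
- apply/disj_setPS => x /=; rewrite !in_itv /= => -[/andP[_ h] /andP[h' _]].
  by move: h'; rewrite ltNge h.
Qed.

Lemma diamond_measure A B d : 0 < d -> mu2 (diamond A B d) = (d ^+ 2 / 2)%:E.
Proof.
move=> d0; rewrite -(integral_tent (B - A) d0) /product_measure1.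
apply: eq_integral => x _ /=; rewrite /tent.
have -> : xsection (diamond A B d) x =
    `]Num.max (A + x) (B - x), Num.min (A + x) (B - x) + d]%classic.
  apply/seteqP; split => y; rewrite /xsection /= in_itv /= inE /= gt_max.
    move=> -[/= h1 h2 h3 h4]; apply/andP; split; first by apply/andP; split; lra.
    by rewrite -lerBlDr le_min; apply/andP; split; lra.
  by rewrite -lerBlDr le_min => /andP[/andP[h1 h2] /andP[h3 h4]]; split => /=; lra.
rewrite lebesgue_measure_itv /= lte_fin -EFinB.
have -> : 2 * x - (B - A) = (A + x) - (B - x) by ring.
set r := A + x; set s := B - x.
case: (leP r s) => rs.
  rewrite ler0_norm ?subr_le0 //; case: ltP => h; congr (_%:E).
    by rewrite (max_idPr _) //; lra.
  by rewrite (max_idPl _) //; lra.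
rewrite gtr0_norm ?subr_gt0 //; case: ltP => h; congr (_%:E).
  by rewrite (max_idPr _) //; lra.
by rewrite (max_idPl _) //; lra.
Qed.

End PlaneSets.

(** * Estimates for [dist_gamma] and its measurability *)

Section LimitShape.

Variables (R : realType) (gamma : R -> R) (M K : R).
Local Open Scope classical_set_scope.
Implicit Types (x y s t r e : R) (z : R * R).

Hypothesis gamma_lip : forall x y, gamma y <= gamma x + `|y - x|.
Hypothesis gamma_bound : forall x, `|x| < gamma x -> `|x| <= M /\ gamma x <= K.

Lemma continuous_lip : continuous gamma.
Proof.
move=> x; apply/cvgrPdist_lt => e e0; near=> y.
have h : `|x - y| < e by near: y; apply: cvgr_dist_lt.
have h1 := gamma_lip x y; have h2 := gamma_lip y x; move: h1; rewrite distrC => h1.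
by rewrite ltr_norml; apply/andP; split; lra.
Unshelve. all: by end_near. Qed.

(** Vertical displacements inside a ball give the strict inequalities; conversely the Lipschitz
    bound makes them stable under small displacements. *)
Lemma interior_region z : (region gamma)° z <-> `|z.1| < z.2 < gamma z.1.
Proof.
case: z => x y /=; split.
  case/nbhs_ballP => e /= e0 h.
  have h' d : `|d| < e -> region gamma (x, y + d).
    move=> de; apply: h; split => /=; first exact: ballxx.
    by rewrite /ball /= opprD addrA subrr sub0r normrN.
  have [] := (h' (e / 2), h' (- (e / 2))); rewrite normrN gtr0_norm ?divr_gt0 //.
  have -> : e / 2 < e by lra.
  by rewrite /region /= => /(_ isT)/andP[_ h1] /(_ isT)/andP[h2 _]; apply/andP; split; lra.
case/andP => xy yg.
(* Half of the smaller gap: the height and the bound it is compared with each move by less than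
   [e]. *)
pose e := Num.min (y - `|x|) (gamma x - y) / 2.
have e1 : 2 * e <= y - `|x| by rewrite /e mulrC divfK // ge_min lexx.
have e2 : 2 * e <= gamma x - y by rewrite /e mulrC divfK // ge_min lexx orbT.
have e0 : 0 < e by rewrite divr_gt0 // lt_min !subr_gt0 xy.
apply/nbhs_ballP; exists e => //= -[x' y'] [/=]; rewrite /ball /= => hx hy.
rewrite /region /=; apply/andP; split.
  have := ler_normD (x' - x) x; rewrite subrK distrC => h.
  by move: hy; rewrite ltr_norml => /andP[hy1 hy2]; lra.
have := gamma_lip x' x => h.
by move: hy; rewrite ltr_norml => /andP[hy1 hy2]; lra.
Qed.

Definition reach z : set R := [set r | exists s t,
  [/\ 0 < s, 0 < t, region gamma (z.1 + s - t, z.2 + s + t) & r = s + t]].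

Lemma dist_gammaE z : `|z.1| < z.2 < gamma z.1 ->
  dist_gamma gamma z = Num.sqrt 2 * sup (reach z).
Proof. by move=> hz; rewrite /dist_gamma ifT //; apply/asboolP/interior_region. Qed.

Lemma dist_gamma_out z : ~~ (`|z.1| < z.2 < gamma z.1) -> dist_gamma gamma z = 0.
Proof. by move=> hz; rewrite /dist_gamma ifF //; apply/asboolP => /interior_region; exact/negP. Qed.

Lemma above_cone z s t : 0 <= s -> 0 <= t -> `|z.1| < z.2 ->
  `|z.1 + s - t| < z.2 + s + t.
Proof. by rewrite !ltr_norml => s0 t0 /andP[h1 h2]; apply/andP; split; lra. Qed.

Lemma reach_ub z : `|z.1| < z.2 -> ubound (reach z) K.
Proof.
move=> hz _ [s [t [s0 t0 /andP[/= _ h2] ->]]].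
have h := above_cone (ltW s0) (ltW t0) hz.
have [_ hK] := gamma_bound (lt_le_trans h h2).
by have := normr_ge0 z.1; lra.
Qed.

Lemma reach_nonempty z : `|z.1| < z.2 < gamma z.1 -> reach z !=set0.
Proof.
case/andP => h1 h2; exists ((gamma z.1 - z.2) / 2 + (gamma z.1 - z.2) / 2).
exists ((gamma z.1 - z.2) / 2), ((gamma z.1 - z.2) / 2).
have e0 : 0 < (gamma z.1 - z.2) / 2 by lra.
split=> //; rewrite /region /= addrK; apply/andP; split; lra.
Qed.

Lemma reach_has_sup z : `|z.1| < z.2 < gamma z.1 -> has_sup (reach z).
Proof.
move=> hz; split; first exact: reach_nonempty.
by exists K; case/andP: hz => /reach_ub.
Qed.

(** The strict inequality leaves room to enlarge [s] and [t] equally, so the zero values excluded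
    from [reach] are allowed here; [s = t = 0] yields [dist_gamma_ge0]. *)
Lemma dist_gamma_ge z s t : 0 <= s -> 0 <= t -> `|z.1| < z.2 ->
  z.2 + s + t < gamma (z.1 + s - t) -> Num.sqrt 2 * (s + t) <= dist_gamma gamma z.
Proof.
move=> s0 t0 h1 h2.
have hz : `|z.1| < z.2 < gamma z.1.
  rewrite h1 /=; have := gamma_lip z.1 (z.1 + s - t).
  have : `|z.1 + s - t - z.1| <= s + t by rewrite ler_norml; apply/andP; split; lra.
  lra.
rewrite dist_gammaE // ler_wpM2l ?sqrtr_ge0 //.
(* Adding [d] to both [s] and [t] keeps the abscissa and lifts the end point exactly onto the graph
   of [gamma]. *)
pose d := (gamma (z.1 + s - t) - (z.2 + s + t)) / 2.
have d0 : 0 < d by rewrite /d; lra.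
apply: le_trans (_ : s + d + (t + d) <= _); first lra.
apply: sup_upper_bound; first exact: reach_has_sup.
exists (s + d), (t + d); split=> //; [lra|lra|].
have -> : z.1 + (s + d) - (t + d) = z.1 + s - t by ring.
have := above_cone s0 t0 h1; rewrite /region /= => h.
by apply/andP; split; rewrite /d in d0 *; lra.
Qed.

Lemma dist_gamma_le z r : 0 <= r ->
  (`|z.1| < z.2 -> forall s t, 0 < s -> 0 < t ->
     z.2 + s + t <= gamma (z.1 + s - t) -> Num.sqrt 2 * (s + t) <= r) ->
  dist_gamma gamma z <= r.
Proof.
move=> r0 h; case: (boolP (`|z.1| < z.2 < gamma z.1)) => hz; last by rewrite dist_gamma_out.
have c0 : 0 < Num.sqrt 2 :> R by rewrite sqrtr_gt0.
rewrite dist_gammaE // mulrC -ler_pdivlMr //; apply: ge_sup; first exact: reach_nonempty.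
move=> _ [s [t [s0 t0 /andP[_ /= hg] ->]]].
by rewrite ler_pdivlMr // mulrC; apply: h => //; case/andP: hz.
Qed.

Lemma dist_gamma_ge0 z : 0 <= dist_gamma gamma z.
Proof.
case: (boolP (`|z.1| < z.2 < gamma z.1)) => hz; last by rewrite dist_gamma_out.
by have := @dist_gamma_ge z 0 0; rewrite !addr0 subr0 mulr0; case/andP: hz => ? ?; apply.
Qed.

Lemma dist_gamma_ltP z r : 0 <= r -> r < dist_gamma gamma z ->
  `|z.1| < z.2 < gamma z.1 /\ exists s t,
  [/\ 0 < s, 0 < t, z.2 + s + t <= gamma (z.1 + s - t) & r < Num.sqrt 2 * (s + t)].
Proof.
move=> r0; case: (boolP (`|z.1| < z.2 < gamma z.1)) => hz; last first.
  by rewrite dist_gamma_out // ltNge r0.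
have c0 : 0 < Num.sqrt 2 :> R by rewrite sqrtr_gt0.
rewrite dist_gammaE // mulrC -ltr_pdivrMr // => /(sup_gt (reach_nonempty hz)).
case=> _ [s [t [s0 t0 /andP[_ h] ->]]] hr; split=> //; exists s, t; split=> //.
by rewrite mulrC -ltr_pdivrMr.
Qed.

Lemma dist_gamma_le_bound z : 0 <= K -> dist_gamma gamma z <= Num.sqrt 2 * K.
Proof.
move=> K0; apply: dist_gamma_le => [|hz s t s0 t0 h].
  by rewrite mulr_ge0 ?sqrtr_ge0.
rewrite ler_wpM2l ?sqrtr_ge0 //; apply: (reach_ub hz); exists s, t; split=> //.
by rewrite /region /= h andbT ltW // (above_cone (ltW s0) (ltW t0) hz).
Qed.

(* By the Lipschitz bound the pair reaching beyond [r] can be shrunk to rationals. *)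
Lemma dist_gamma_superlevel r : 0 <= r ->
  [set z | r < dist_gamma gamma z] =
  \bigcup_(a : rat) \bigcup_(b : rat) [set z : R * R |
    [&& `|z.1| < z.2, 0 < ratr a :> R, 0 < ratr b :> R,
        r < Num.sqrt 2 * (ratr a + ratr b) &
        z.2 + ratr a + ratr b < gamma (z.1 + ratr a - ratr b)]].
Proof.
move=> r0; have c0 : 0 < Num.sqrt 2 :> R by rewrite sqrtr_gt0.
apply/seteqP; split => z /=; last first.
  case=> a _ [b _] /= /and5P[h1 a0 b0 hr hg]; apply: lt_le_trans hr _.
  by apply: dist_gamma_ge; rewrite ?ltW.
move=> /(dist_gamma_ltP r0)[/andP[h1 h2] [s [t [s0 t0 hg]]]].
rewrite mulrC -ltr_pdivrMr // => hr.
(* Lowering [s] and [t] by less than [e] keeps both positive and their sum above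
   [r / Num.sqrt 2]. *)
pose e := Num.min (Num.min s t) ((s + t - r / Num.sqrt 2) / 2).
have es : e <= s by rewrite /e !ge_min lexx.
have et : e <= t by rewrite /e !ge_min lexx orbT.
have er : e <= (s + t - r / Num.sqrt 2) / 2 by rewrite /e ge_min lexx orbT.
have e0 : 0 < e by rewrite /e !lt_min s0 t0 /=; lra.
have se : s - e < s by lra.
have [a] := rat_in_itvoo se.
rewrite in_itv /= => /andP[a1 a2].
have te : t - e < t by lra.
have [b] := rat_in_itvoo te.
rewrite in_itv /= => /andP[b1 b2].
exists a => //; exists b => //=; apply/and5P; split=> //; [lra|lra| |].
  by rewrite mulrC -ltr_pdivrMr //; lra.
(* The height drops by [(s - a) + (t - b)] while the abscissa moves by strictly less, so the
   inequality with [gamma] becomes strict. *)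
have := gamma_lip (z.1 + ratr a - ratr b) (z.1 + s - t).
suff : `|z.1 + s - t - (z.1 + ratr a - ratr b)| < (s - ratr a) + (t - ratr b) by lra.
by rewrite ltr_norml; apply/andP; split; lra.
Qed.

Lemma measurable_dist_gamma : measurable_fun setT (dist_gamma gamma).
Proof.
move=> mT; apply: (measurability _ (RGenOInfty.measurableE R)) => //.
move=> _ [_ [r ->] <-]; rewrite setTI preimage_itvoy.
case: (leP 0 r) => r0; last first.
  rewrite (_ : [set _ | _] = setT) //; apply/seteqP; split => z //= _.
  exact: lt_le_trans r0 (dist_gamma_ge0 z).
rewrite dist_gamma_superlevel //; do 2 apply: bigcupT_measurable_rat => ?.
have mf c : measurable_fun setT (fun z : R * R => z.1 + c).
  exact: measurable_funD.
have ms c : measurable_fun setT (fun z : R * R => z.2 + c).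
  exact: measurable_funD.
apply: measurable_setP; repeat apply: measurable_and => //.
  by apply: measurable_fun_ltr => //; exact: measurableT_comp.
apply: measurable_fun_ltr.
  by under eq_fun do rewrite -addrA; exact: ms.
apply: (measurableT_comp (continuous_measurable_fun continuous_lip)).
by under eq_fun do rewrite -addrA; exact: mf.
Qed.

End LimitShape.

(** * The rescaled diagram as a union of squares, and the step function on it *)

Section DiscreteShape.

Variables (R : realType) (lam : seq nat).
Local Open Scope classical_set_scope.
Implicit Types (x y a s t e : R) (z : R * R) (c d : cell lam).

Hypothesis lam_sorted : sorted geq lam.
Hypothesis lam_gt0 : (0 < sumn lam)%N.

Let n : R := (sumn lam)%:R.
Let k : R := Num.sqrt n / Num.sqrt 2.

Let n_gt0 : 0 < n. Proof. by rewrite ltr0n. Qed.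

Let k_gt0 : 0 < k. Proof. by rewrite divr_gt0 ?sqrtr_gt0. Qed.

Lemma nat_ceil_le (i j : nat) (v w : R) :
  i%:R < v -> v <= w -> w <= j.+1%:R -> (i <= j)%N.
Proof. by move=> iv vw wj; rewrite -ltnS -(ltr_nat R) (lt_le_trans iv) // (le_trans vw). Qed.

Lemma nat_ceilP (v : R) : 0 < v ->
  `|Num.ceil v|.-1%:R < v <= `|Num.ceil v|.-1.+1%:R.
Proof.
move=> v0; have c0 : (0 < Num.ceil v)%R by rewrite ceil_gt0.
have := ceil_itv v; case: (Num.ceil v) c0 => // -[|m] //= _.
by rewrite -[Posz m.+1]/(m.+1%:Z) -addn1 PoszD addrK !pmulrn.
Qed.

Lemma nat_ceil_eq (i : nat) (v : R) : i%:R < v <= i.+1%:R -> `|Num.ceil v|.-1 = i.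
Proof.
move=> /andP[i1 i2]; have v0 : 0 < v by apply: le_lt_trans i1.
have /andP[h1 h2] := nat_ceilP v0.
by apply/eqP; rewrite eqn_leq (nat_ceil_le h1 (lexx v) i2) (nat_ceil_le i1 (lexx v) h2).
Qed.

(** The rescaled diagram without its two half-axes, which form the graph of the absolute value. *)
Definition in_diagram z : Prop :=
  [/\ 0 < k * (z.1 + z.2), 0 < k * (z.2 - z.1) &
  k * (z.1 + z.2) <= (nth 0%N lam `|Num.ceil (k * (z.2 - z.1))|.-1)%:R].

Lemma scaled_diagramE z : scaled_diagram lam z <->
  in_diagram z \/ z.2 = `|z.1|.
Proof.
rewrite /scaled_diagram /= -/n -/k /in_diagram; split.
  case=> [[h1 /andP[h2 h3]]|[h1 h2 h3]]; [by left|right].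
  move: h1 h2; rewrite !(pmulr_rge0 _ k_gt0) => h1 h2.
  move/eqP: h3; rewrite mulf_eq0 => /orP[]; rewrite mulf_eq0 gt_eqF //= => /eqP h.
    by rewrite ler0_norm; lra.
  by rewrite ger0_norm; lra.
case=> [[h1 h2 h3]|h]; [by left; split=> //; rewrite h1|right].
rewrite !(pmulr_rge0 _ k_gt0) h; case: (ger0P z.1) => z0; split; lra.
Qed.

Lemma in_diagram_gt z : in_diagram z -> `|z.1| < z.2.
Proof.
case=> h1 h2 _; move: h1 h2; rewrite !(pmulr_rgt0 _ k_gt0) => h1 h2.
by rewrite ltr_norml; apply/andP; split; lra.
Qed.

(** A crude bound, whose purpose is to make the supremum in [boundary] a genuine one. *)
Lemma in_diagram_bounded z : in_diagram z ->
  z.2 <= ((sumn lam)%:R + (size lam)%:R) / k.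
Proof.
case=> h1 h2 h3; rewrite ler_pdivlMr // mulrC.
have nth_sum i : (nth 0%N lam i <= sumn lam)%N.
  elim: lam i => [|m s IH] [|i] //=; first exact: leq_addr.
  exact: leq_trans (IH i) (leq_addl _ _).
have : k * (z.1 + z.2) <= (sumn lam)%:R by apply: le_trans h3 _; rewrite ler_nat.
have : k * (z.2 - z.1) <= (size lam)%:R.
  have /andP[_ h] := nat_ceilP h2; apply: le_trans h _; rewrite ler_nat ltnNge.
  (* A row index past the end of [lam] would give the default part 0, against the positivity of the
     other coordinate. *)
  apply/negP => /(nth_default 0%N) e; by move: h3; rewrite e leNgt h1.
have : 0 <= (sumn lam)%:R :> R by []. have : 0 <= (size lam)%:R :> R by [].
lra.
Qed.

Lemma in_diagram_boundary z : in_diagram z -> z.2 <= boundary lam z.1.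
Proof.
move=> hz; apply: ub_le_sup; last by apply/scaled_diagramE; left; case: z hz.
exists (`|z.1| + ((sumn lam)%:R + (size lam)%:R) / k) => y /= /scaled_diagramE.
have p0 : 0 <= ((sumn lam)%:R + (size lam)%:R) / k by rewrite divr_ge0 ?addr_ge0 // ltW.
have x0 := normr_ge0 z.1; case=> [/in_diagram_bounded|] /=; lra.
Qed.

(** Some diagram point lies higher on the same vertical line; going down decreases both rotated
    coordinates, and the parts can only grow as the row index falls. *)
Lemma in_diagram_below z : `|z.1| < z.2 -> z.2 < boundary lam z.1 -> in_diagram z.
Proof.
move=> hz /sup_gt []; first by exists `|z.1|; apply/scaled_diagramE; right.
move=> y /= /scaled_diagramE /= [[/= h1 h2 h3]|->] zy; last by lra.
move: hz; rewrite ltr_norml => /andP[z1 z2].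
split; rewrite ?(pmulr_rgt0 _ k_gt0) //; [lra|lra|].
have uu : k * (z.1 + z.2) <= k * (z.1 + y) by rewrite ler_wpM2l ?(ltW k_gt0) //; lra.
have vv : k * (z.2 - z.1) <= k * (y - z.1) by rewrite ler_wpM2l ?(ltW k_gt0) //; lra.
apply: le_trans uu (le_trans h3 _); rewrite ler_nat part_antitone //.
have v0 : 0 < k * (z.2 - z.1) by rewrite (pmulr_rgt0 _ k_gt0); lra.
have /andP[a1 a2] := nat_ceilP v0; have /andP[b1 b2] := nat_ceilP h2.
exact: nat_ceil_le a1 vv b2.
Qed.

(** The square of the cell [c] in the rescaled picture, translated down by [a]. *)
Definition cell_diamond a c : set (R * R) :=
  diamond ((cell_row c)%:R / k - a) ((cell_col c)%:R / k - a) k^-1.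

Lemma cell_diamondP a c z : cell_diamond a c z <->
  (cell_row c)%:R < k * (z.2 + a - z.1) <= (cell_row c).+1%:R /\
  (cell_col c)%:R < k * (z.1 + (z.2 + a)) <= (cell_col c).+1%:R.
Proof.
have lE (m : nat) (w : R) : (m%:R < k * w) = (m%:R / k < w).
  by rewrite ltr_pdivrMr // mulrC.
have rE (m : nat) (w : R) : (k * w <= m.+1%:R) = (w <= m%:R / k + k^-1).
  by rewrite -[X in _ + X]mul1r -mulrDl ler_pdivlMr // mulrC -natr1.
rewrite !lE !rE /cell_diamond /diamond /=; split.
  by case=> h1 h2 h3 h4; split; apply/andP; split; lra.
by case=> /andP[h1 h2] /andP[h3 h4]; split; lra.
Qed.

Lemma cell_diamond_shift a c z : cell_diamond a c z <-> cell_diamond 0 c (z.1, z.2 + a).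
Proof. by rewrite !cell_diamondP /= addr0. Qed.

Lemma cell_diamond_unique a c d z : cell_diamond a c z -> cell_diamond a d z -> c = d.
Proof.
move=> /cell_diamondP[c1 c2] /cell_diamondP[d1 d2].
by apply: cell_inj; [rewrite -(nat_ceil_eq c1) (nat_ceil_eq d1) |
  rewrite -(nat_ceil_eq c2) (nat_ceil_eq d2)].
Qed.

Lemma cell_diamond_in c z : cell_diamond 0 c z -> in_diagram z.
Proof.
move=> /cell_diamondP; rewrite addr0 => -[h1 h2].
have [/andP[v1 _] /andP[u1 u2]] := (h1, h2).
split; [exact: le_lt_trans u1|exact: le_lt_trans v1|].
rewrite (nat_ceil_eq h1); apply: le_trans u2 _; rewrite ler_nat.
exact: (valP c).
Qed.

Lemma in_diagram_cell z : in_diagram z -> exists c, cell_diamond 0 c z.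
Proof.
case=> h1 h2 h3; have hu := nat_ceilP h1; have hv := nat_ceilP h2.
set i := `|Num.ceil (k * (z.2 - z.1))|.-1 in h3 hv *.
set j := `|Num.ceil (k * (z.1 + z.2))|.-1 in hu *.
have ji : (j < nth 0%N lam i)%N.
  by rewrite -(ltr_nat R); apply: lt_le_trans h3; case/andP: hu.
have hi : (i < size lam)%N.
  by rewrite ltnNge; apply/negP => /(nth_default 0%N) e; rewrite e in ji.
have hj : (j < head 0%N lam)%N.
  by apply: leq_trans ji _; rewrite -nth0 part_antitone.
have p : ((Ordinal hi, Ordinal hj).2 < nth 0%N lam (Ordinal hi, Ordinal hj).1)%N by [].
by exists (exist _ (Ordinal hi, Ordinal hj) p); apply/cell_diamondP; rewrite addr0.
Qed.

(** The side of a rescaled cell is [1 / Num.sqrt n], so this is the rescaled length of the longest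
    lattice path from [c]. *)
Definition cell_weight c : R := (max_deg c - cell_deg c)%:R / Num.sqrt n.

Definition step_dist a z : R := \sum_c cell_weight c * \1_(cell_diamond a c) z.

Lemma cell_weight_ge0 c : 0 <= cell_weight c.
Proof. by rewrite divr_ge0 ?sqrtr_ge0. Qed.

Lemma step_dist_ge0 a z : 0 <= step_dist a z.
Proof. by apply: sumr_ge0 => c _; rewrite mulr_ge0 ?cell_weight_ge0. Qed.

Lemma step_distE a c z : cell_diamond a c z -> step_dist a z = cell_weight c.
Proof.
move=> hc; rewrite /step_dist (bigD1 c) //= indicE mem_set // mulr1 big1 ?addr0 //.
move=> d dc; rewrite indicE memNset ?mulr0 // => hd.
by rewrite (cell_diamond_unique hd hc) eqxx in dc.
Qed.

Lemma step_dist_cases a z : step_dist a z = 0 \/ exists c, cell_diamond a c z.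
Proof.
case: (pselect (exists c, cell_diamond a c z)) => [|no]; [by right|left].
apply: big1 => c _; rewrite indicE memNset ?mulr0 // => hc; apply: no; by exists c.
Qed.

(** A diagonal displacement by [w] in each coordinate has length [Num.sqrt 2 * w] and crosses
    [k * (w + w)] cells. *)
Lemma sqrt_scale (w : R) : k * (w + w) = Num.sqrt n * (Num.sqrt 2 * w).
Proof.
have c0 : Num.sqrt 2 != 0 :> R by rewrite gt_eqF // sqrtr_gt0.
have c2 : Num.sqrt 2 * Num.sqrt 2 = 2 :> R by rewrite -expr2 sqr_sqrtr.
have sn : Num.sqrt n = k * Num.sqrt 2 by rewrite /k divfK.
have -> : w + w = Num.sqrt 2 * Num.sqrt 2 * w by rewrite c2 mulrDl mul1r.
by rewrite sn !mulrA.
Qed.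

Lemma step_path c z : cell_diamond 0 c z -> exists s t,
  [/\ 0 <= s, 0 <= t, cell_weight c = Num.sqrt 2 * (s + t) &
      in_diagram (z.1 + s - t, z.2 + s + t)].
Proof.
move=> hc; have [d /andP[rd cd] dd] := max_deg_attained c.
(* This moves [z] to the same relative position in the square of [d], a cell where [max_deg c] is
   attained. *)
exists ((cell_col d - cell_col c)%:R / k / 2), ((cell_row d - cell_row c)%:R / k / 2).
set s := _ / k / 2; set t := _ / k / 2.
have ks : k * (s + s) = (cell_col d - cell_col c)%:R.
  by rewrite -splitr mulrC divfK // gt_eqF.
have kt : k * (t + t) = (cell_row d - cell_row c)%:R.
  by rewrite -splitr mulrC divfK // gt_eqF.
split; [by rewrite !divr_ge0 // ltW|by rewrite !divr_ge0 // ltW| |].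
  have q0 : 0 < Num.sqrt n by rewrite sqrtr_gt0.
  apply: (mulfI (lt0r_neq0 q0)); rewrite [in LHS]mulrC divfK ?gt_eqF //.
  rewrite [_ * (s + t)]mulrDr [RHS]mulrDr -!sqrt_scale ks kt -natrD -dd /cell_deg.
  by congr (_%:R); lia.
apply: (@cell_diamond_in d); apply/cell_diamondP => /=; rewrite addr0.
have [+ +] := (cell_diamondP 0 c z).1 hc; rewrite addr0.
have -> : z.2 + s + t - (z.1 + s - t) = z.2 - z.1 + (t + t) by ring.
have -> : z.1 + s - t + (z.2 + s + t) = z.1 + z.2 + (s + s) by ring.
rewrite !(mulrDr k _ (_ + _)) ks kt !natrB // -!natr1.
by move=> /andP[v1 v2] /andP[u1 u2]; split; apply/andP; split; lra.
Qed.

(** The displacement exceeds the difference of the cell indices by less than one cell in each of the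
    two diagonal directions, hence the error [2 / Num.sqrt n]. *)
Lemma step_path_le c d z s t : 0 <= s -> 0 <= t -> cell_diamond 0 c z ->
  cell_diamond 0 d (z.1 + s - t, z.2 + s + t) ->
  Num.sqrt 2 * (s + t) <= cell_weight c + 2 / Num.sqrt n.
Proof.
move=> s0 t0 /cell_diamondP[+ +] /cell_diamondP[+ +] /=; rewrite !addr0.
have -> : z.2 + s + t - (z.1 + s - t) = z.2 - z.1 + (t + t) by ring.
have -> : z.1 + s - t + (z.2 + s + t) = z.1 + z.2 + (s + s) by ring.
move=> /andP[cv _] /andP[cu _] /andP[_ dv] /andP[_ du].
have le w r : 0 <= r -> k * w <= k * (w + (r + r)).
  by move=> r0; rewrite ler_wpM2l ?(ltW k_gt0) //; lra.
have cd : cell_below c d.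
  by rewrite /cell_below (nat_ceil_le cv (le _ _ t0) dv) (nat_ceil_le cu (le _ _ s0) du).
have dm := cell_deg_le_max cd.
rewrite /cell_weight -mulrDl ler_pdivlMr ?sqrtr_gt0 // mulrC.
rewrite [_ * (s + t)]mulrDr [X in X <= _]mulrDr -!sqrt_scale.
have : (cell_deg d)%:R <= (max_deg c)%:R :> R by rewrite ler_nat.
rewrite natrB ?cell_deg_le_max ?cell_below_refl //.
rewrite [cell_deg d]/cell_deg [cell_deg c]/cell_deg !natrD.
move: cv cu dv du; rewrite !(mulrDr k _ (_ + _)) -!natr1; lra.
Qed.

Variables (gamma : R -> R) (M K e : R).
Hypothesis gamma_lip : forall x y, gamma y <= gamma x + `|y - x|.
Hypothesis gamma_bound : forall x, `|x| < gamma x -> `|x| <= M /\ gamma x <= K.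
Hypothesis boundary_bound :
  forall x, `|x| < boundary lam x -> `|x| <= M /\ boundary lam x <= K.
Hypothesis e_gt0 : 0 < e.
Hypothesis K_ge0 : 0 <= K.

(* Moving down by [2 e] leaves room [e] between the shifted path and [gamma]. *)
Lemma step_dist_le z : (forall x, boundary lam x <= gamma x + e) ->
  step_dist (2 * e) z <= dist_gamma gamma z +
    Num.sqrt 2 * K * \1_(cone_strip M (- (2 * e)) 0) z.
Proof.
case: z => x y close; have e0 := e_gt0; have K0 := K_ge0.
have c0 : 0 <= Num.sqrt 2 :> R by rewrite sqrtr_ge0.
have d0 := dist_gamma_ge0 gamma_lip gamma_bound (x, y).
have i0 : 0 <= Num.sqrt 2 * K * \1_(cone_strip M (- (2 * e)) 0) (x, y) :> R.
  by rewrite !mulr_ge0.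
case: (step_dist_cases (2 * e) (x, y)) => [->|[c hc]]; first exact: addr_ge0.
rewrite (step_distE hc).
have /cell_diamond_shift hp := hc.
have [s [t [s0 t0 -> hq]]] := step_path hp; rewrite /= in hq.
have := in_diagram_boundary hq; rewrite /= => q2.
have hz := in_diagram_gt (cell_diamond_in hp); rewrite /= in hz.
case: (ltP `|x| y) => hz2.
  apply: ler_wpDr i0 _; apply: (dist_gamma_ge gamma_lip gamma_bound) => //=.
  by have := close (x + s - t); lra.
(* Here the point is not above the cone, so it lies in the strip; the path ends at height at most
   [K], which bounds its length by [Num.sqrt 2 * K]. *)
apply: ler_wpDl d0 _; rewrite -mulrA ler_wpM2l //.
have [_ /= qK] := boundary_bound (lt_le_trans (in_diagram_gt hq) q2).
have := in_diagram_boundary (cell_diamond_in hp); rewrite /= => p2.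
have [zM _] := boundary_bound (lt_le_trans hz p2).
rewrite indicE mem_set ?mulr1; first by have := normr_ge0 x; lra.
by split=> //=; lra.
Qed.

(** Lowered by [2 * e], both ends of a path under [gamma] fall strictly under the discrete boundary,
    so [step_path_le] applies to their cells. The second term is its discretization error; the third
    covers the points that leave the cone when lowered. *)
Lemma dist_gamma_le_step z : (forall x, gamma x <= boundary lam x + e) ->
  dist_gamma gamma z <= step_dist (- (2 * e)) z +
    2 / Num.sqrt n * \1_(cone_strip M 0 K) z +
    Num.sqrt 2 * K * \1_(cone_strip M 0 (2 * e)) z.
Proof.
case: z => x y close; have e0 := e_gt0; have K0 := K_ge0.
have c0 : 0 <= Num.sqrt 2 :> R by rewrite sqrtr_ge0.
have h0 := step_dist_ge0 (- (2 * e)) (x, y).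
have i1 : 0 <= 2 / Num.sqrt n * \1_(cone_strip M 0 K) (x, y) :> R.
  by rewrite !mulr_ge0 // invr_ge0 sqrtr_ge0.
have i2 : 0 <= Num.sqrt 2 * K * \1_(cone_strip M 0 (2 * e)) (x, y) :> R.
  by rewrite !mulr_ge0.
case: (boolP (`|x| < y < gamma x)) => [/andP[z1 z2]|hz]; last first.
  by rewrite (dist_gamma_out gamma_lip) // !addr_ge0.
have [zM zK] := gamma_bound (lt_trans z1 z2).
have x0 := normr_ge0 x.
case: (leP y (`|x| + 2 * e)) => hz.
  apply: ler_wpDl; first exact: addr_ge0.
  rewrite indicE mem_set ?mulr1; first by apply: (dist_gamma_le_bound gamma_lip gamma_bound).
  by split=> //=; lra.
apply: ler_wpDr i2 _.
rewrite [\1_(cone_strip M 0 K) (x, y)]indicE [(x, y) \in _]mem_set ?mulr1; last by split=> //=; lra.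
apply: (dist_gamma_le gamma_lip) => [|_ s t s0 t0 /= hg].
  by rewrite addr_ge0 // divr_ge0 // sqrtr_ge0.
have /in_diagram_cell[c hc] : in_diagram (x, y - 2 * e).
  by apply: in_diagram_below => /=; [lra|have := close x; lra].
have /in_diagram_cell[d hd] : in_diagram (x + s - t, y - 2 * e + s + t).
  apply: in_diagram_below => /=.
    by apply: (above_cone (z := (x, y - 2 * e)) (ltW s0) (ltW t0)) => /=; lra.
  by have := close (x + s - t); lra.
rewrite (step_distE (a := - (2 * e)) (c := c)); last exact/cell_diamond_shift.
exact: step_path_le (ltW s0) (ltW t0) hc hd.
Qed.

End DiscreteShape.

(** * Comparison of the worst case with the integral of [dist_gamma] *)

Section IntegralBounds.

Variables (R : realType) (lam : seq nat).
Local Open Scope classical_set_scope.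
Local Notation mu := (@lebesgue_measure R).
Local Notation mu2 := (mu \x mu)%E.

Hypothesis lam_sorted : sorted geq lam.
Hypothesis lam_gt0 : (0 < sumn lam)%N.

Let n : R := (sumn lam)%:R.

Lemma integral_scaled_indic (w : R) (A : set (R * R)) : 0 <= w -> measurable A ->
  (\int[mu2]_z (w * \1_A z)%:E = w%:E * mu2 A)%E.
Proof.
move=> w0 mA; under eq_integral do rewrite EFinM.
rewrite ge0_integralZl //; first by rewrite integral_indic // setIT.
by apply/measurable_EFinP; exact: measurable_indic.
Qed.

Lemma measurable_scaled_indic (w : R) (A : set (R * R)) : measurable A ->
  measurable_fun [set: R * R] (fun z => w * \1_A z : R).
Proof. by move=> mA; apply: measurable_funM => //; exact: measurable_indic. Qed.

Lemma measurable_cell_diamond (a : R) (c : cell lam) : measurable (cell_diamond a c).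
Proof. exact: measurable_diamond. Qed.

Lemma measurable_step_dist (a : R) : measurable_fun [set: R * R] (step_dist lam a).
Proof.
apply: measurable_sum => c; apply: measurable_scaled_indic.
exact: measurable_cell_diamond.
Qed.

Lemma cell_diamond_measure (a : R) (c : cell lam) : mu2 (cell_diamond a c) = (n^-1)%:E.
Proof.
rewrite diamond_measure ?invr_gt0 ?divr_gt0 ?sqrtr_gt0 ?ltr0n //; congr (_%:E).
by rewrite exprVn expr_div_n !sqr_sqrtr // invf_div mulrAC divff // mul1r.
Qed.

(** The value does not depend on the shift [a], since each translated square has area [1 / n]; this
    is what allows the comparison with shifted step functions. *)
Lemma integral_step_dist (a : R) : (\int[mu2]_z (step_dist lam a z)%:E =
  ((worst_case lam)%:R / (n * Num.sqrt n))%:E)%E.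
Proof.
under eq_integral do rewrite -sumEFin.
rewrite ge0_integral_sum //; last 2 first.
- move=> c; apply/measurable_EFinP; apply: measurable_scaled_indic.
  exact: measurable_cell_diamond.
- by move=> c z _; rewrite lee_fin mulr_ge0 // cell_weight_ge0.
under eq_bigr => c _.
  rewrite integral_scaled_indic ?cell_weight_ge0 //; last exact: measurable_cell_diamond.
  rewrite cell_diamond_measure -EFinM.
  over.
rewrite sumEFin worst_caseE // natr_sum !mulr_suml; congr (_%:E).
by apply: eq_bigr => c _; rewrite /cell_weight invfM mulrA mulrAC.
Qed.

Variables (gamma : R -> R) (M K e : R).
Hypothesis gamma_lip : forall x y, gamma y <= gamma x + `|y - x|.
Hypothesis gamma_bound : forall x, `|x| < gamma x -> `|x| <= M /\ gamma x <= K.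
Hypothesis boundary_bound :
  forall x, `|x| < boundary lam x -> `|x| <= M /\ boundary lam x <= K.
Hypothesis e_gt0 : 0 < e.
Hypothesis M_ge0 : 0 <= M.
Hypothesis K_gt0 : 0 < K.

Lemma worst_case_le_integral : (forall x, boundary lam x <= gamma x + e) ->
  (((worst_case lam)%:R / (n * Num.sqrt n))%:E <=
   \int[mu2]_z (dist_gamma gamma z)%:E +
   (Num.sqrt 2 * K * (2 * e * (M + M)))%:E)%E.
Proof.
move=> close; have e0 := e_gt0; have K0 := ltW K_gt0.
have c0 : 0 <= Num.sqrt 2 * K by rewrite mulr_ge0 ?sqrtr_ge0.
have mS := measurable_cone_strip M (- (2 * e)) 0.
have -> : (Num.sqrt 2 * K * (2 * e * (M + M)))%:E =
    (\int[mu2]_z (Num.sqrt 2 * K * \1_(cone_strip M (- (2 * e)) 0) z)%:E)%E.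
  rewrite integral_scaled_indic // cone_strip_measure ?sub0r ?opprK -?EFinM //.
  by rewrite oppr_lt0 mulr_gt0.
have md : measurable_fun [set: R * R] (fun z => (dist_gamma gamma z)%:E).
  by apply/measurable_EFinP; exact: measurable_dist_gamma gamma_lip gamma_bound.
have mi := measurable_scaled_indic (Num.sqrt 2 * K) mS.
have d0 := dist_gamma_ge0 gamma_lip gamma_bound.
rewrite -(integral_step_dist (2 * e)) -ge0_integralD //.
- apply: ge0_le_integral => //.
  + by move=> z _; rewrite lee_fin step_dist_ge0.
  + by apply/measurable_EFinP; exact: measurable_step_dist.
  + by apply: emeasurable_funD => //; exact/measurable_EFinP.
  + move=> z _; rewrite -EFinD lee_fin.
    exact: step_dist_le gamma_lip gamma_bound boundary_bound e_gt0 K0 z close.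
- by move=> z _; rewrite lee_fin.
- by move=> z _; rewrite lee_fin mulr_ge0.
- exact/measurable_EFinP.
Qed.

(** As the right-hand side is a real number, this also shows that the integral is finite. *)
Lemma integral_le_worst_case : (forall x, gamma x <= boundary lam x + e) ->
  (\int[mu2]_z (dist_gamma gamma z)%:E <=
   ((worst_case lam)%:R / (n * Num.sqrt n) + 2 / Num.sqrt n * (K * (M + M)) +
    Num.sqrt 2 * K * (2 * e * (M + M)))%:E)%E.
Proof.
move=> close; have e0 := e_gt0; have K0 := ltW K_gt0.
have c0 : 0 <= Num.sqrt 2 * K by rewrite mulr_ge0 ?sqrtr_ge0.
have b0 : 0 <= 2 / Num.sqrt n by rewrite divr_ge0 ?sqrtr_ge0.
have mS := measurable_cone_strip M 0 (2 * e).
have mB := measurable_cone_strip M 0 K.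
have mi := measurable_scaled_indic (Num.sqrt 2 * K) mS.
have mj := measurable_scaled_indic (2 / Num.sqrt n) mB.
have md : measurable_fun [set: R * R] (fun z => (dist_gamma gamma z)%:E).
  by apply/measurable_EFinP; exact: measurable_dist_gamma gamma_lip gamma_bound.
have ms := measurable_step_dist (- (2 * e)).
have -> : ((worst_case lam)%:R / (n * Num.sqrt n) + 2 / Num.sqrt n * (K * (M + M)) +
    Num.sqrt 2 * K * (2 * e * (M + M)))%:E =
    (\int[mu2]_z (step_dist lam (- (2 * e)) z +
       2 / Num.sqrt n * \1_(cone_strip M 0 K) z +
       Num.sqrt 2 * K * \1_(cone_strip M 0 (2 * e)) z)%:E)%E.
  under eq_integral do rewrite !EFinD.
  rewrite ge0_integralD //=; last 4 first.
  - by move=> z _; rewrite -EFinD lee_fin addr_ge0 ?step_dist_ge0 ?mulr_ge0.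
  - by apply: emeasurable_funD; exact/measurable_EFinP.
  - by move=> z _; rewrite lee_fin mulr_ge0.
  - exact/measurable_EFinP.
  rewrite ge0_integralD //=; last 3 first.
  - by move=> z _; rewrite lee_fin step_dist_ge0.
  - exact/measurable_EFinP.
  - exact/measurable_EFinP.
  rewrite integral_step_dist !integral_scaled_indic //.
  by rewrite !cone_strip_measure ?subr0 ?mulr_gt0 // -!EFinM -!EFinD.
apply: ge0_le_integral => //.
- by move=> z _; rewrite lee_fin (dist_gamma_ge0 gamma_lip gamma_bound).
- by apply/measurable_EFinP; apply: measurable_funD => //; apply: measurable_funD.
- move=> z _; rewrite lee_fin.
  exact: dist_gamma_le_step gamma_lip gamma_bound e_gt0 K0 z close.
Qed.

End IntegralBounds.

(** * Uniform constants and passage to the limit *)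

Section Asymptotics.

Variable R : realType.
Local Open Scope classical_set_scope.
Local Notation mu := (@lebesgue_measure R).
Local Notation mu2 := (mu \x mu)%E.

Lemma gamma_lipschitz (gamma : R -> R) : Gamma gamma ->
  forall x y, gamma y <= gamma x + `|y - x|.
Proof.
move=> [lip _] x y; have := lip (y, x) (conj I I); rewrite /= mul1r.
by move=> /(le_trans (ler_norm _)); lra.
Qed.

(** Outside the region [dist_gamma] vanishes, so the integral may be taken over the whole plane. *)
Lemma region_integral (gamma : R -> R) (I : R) : Gamma gamma ->
  (\int[mu2]_z (dist_gamma gamma z)%:E = I%:E)%E ->
  \int[mu2]_(z in region gamma) dist_gamma gamma z = I.
Proof.
move=> hg hI; rewrite /Rintegral integral_mkcond.
rewrite (_ : \int[_]_z _ = I%:E)%E // -hI; apply: eq_integral => z _.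
rewrite patchE; case: ifPn => //; rewrite notin_setE => hz.
rewrite (dist_gamma_out (gamma_lipschitz hg)) //; apply/negP => /andP[h1 h2].
by apply: hz; rewrite /region /= !ltW.
Qed.

Lemma powR_3half (x : R) : 0 < x -> x `^ (3 / 2) = x * Num.sqrt x.
Proof.
move=> x0; rewrite (_ : 3 / 2 = 1 + 2^-1 :> R); last by field.
by rewrite powRD ?powRr1 ?powR12_sqrt ?ltW // gt_eqF ?implybT.
Qed.

Lemma converges_uniformly_near (lam : nat -> seq nat) (gamma : R -> R) (e : R) :
  converges_uniformly lam gamma -> 0 < e ->
  \forall m \near \oo, forall x, `|gamma x - boundary (lam m) x| <= e.
Proof.
move=> [cvg0 _] e0.
have : nbhs (0%E : \bar R) [set z | (z < e%:E)%E].
  by apply: open_ereal_lt'; rewrite lte_fin.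
move=> /cvg0; rewrite nbhs_filterE /= /fmap /=; apply: filterS => m /= hm x.
rewrite -lee_fin ltW //.
by apply: le_lt_trans hm; apply: ereal_sup_ubound; exists x.
Qed.

(** [M] covers both the interval of [gamma] and the common interval of the boundaries. [K] comes
    from the Lipschitz bound starting at 0, with 1 added for boundaries at distance at most 1 from
    [gamma]. *)
Lemma shape_bounds (lam : nat -> seq nat) (gamma : R -> R) :
  Gamma gamma -> converges_uniformly lam gamma ->
  exists M K : R, [/\ 0 <= M, 0 < K,
    forall x, `|x| < gamma x -> `|x| <= M /\ gamma x <= K &
    forall m, (0 < m)%N -> (forall x, `|gamma x - boundary (lam m) x| <= 1) ->
    forall x, `|x| < boundary (lam m) x -> `|x| <= M /\ boundary (lam m) x <= K].
Proof.
move=> hg [_ [a' [b' hb]]]; have lip := gamma_lipschitz hg.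
case: hg => _ [a [b hab]].
pose M := `|a| + `|b| + `|a'| + `|b'|.
have [[a0 b0] [a'0 b'0]] := ((normr_ge0 a, normr_ge0 b), (normr_ge0 a', normr_ge0 b')).
have M0 : 0 <= M by rewrite /M; lra.
have inM (u v x : R) : `|u| + `|v| <= M -> x \in `]u, v[ -> `|x| <= M.
  rewrite inE /= in_itv /= => uvM /andP[ux xv].
  have := ler_norm v; have := ler_norm (- u); rewrite normrN => hu hv.
  have := normr_ge0 u; have := normr_ge0 v => v0 u0.
  by rewrite ler_norml; apply/andP; split; lra.
have g0 := ler_norm (gamma 0).
exists M, (`|gamma 0| + M + 1); split=> //.
- by have := normr_ge0 (gamma 0); lra.
- move=> x xg; have xM : `|x| <= M.
    apply: (inM a b); first by rewrite /M; lra.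
    by apply/negPn/negP => /hab h; rewrite h ltxx in xg.
  by split=> //; have := lip 0 x; rewrite subr0; lra.
- move=> m m0 close x xb; have xM : `|x| <= M.
    apply: (inM a' b'); first by rewrite /M; lra.
    by apply/negPn/negP => /(hb _ _ m0) h; rewrite h ltxx in xb.
  split=> //; have := lip 0 x; rewrite subr0.
  by have := close x; rewrite ler_norml => /andP[h _]; lra.
Qed.

End Asymptotics.

Local Open Scope classical_set_scope.

Theorem theorem3p2 (R : realType) (lam : nat -> seq nat) (gamma : R -> R)
    (lam_part : forall n, (0 < n)%N -> is_partition n (lam n))
    (gamma1 : Gamma1 gamma)
    (lam_cvg : converges_uniformly lam gamma) :
  (fun n => (worst_case (lam n))%:R : R) =
  (fun n => n%:R `^ (3 / 2) *
     \int[(lebesgue_measure \x lebesgue_measure)%E]_(z in region gamma)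
        dist_gamma gamma z)
  +o_\oo (fun n => n%:R `^ (3 / 2)).
Proof.
have [hg _] := gamma1; have lip := gamma_lipschitz hg.
have [M [K [M0 K0 gb bb]]] := shape_bounds hg lam_cvg.
(* [A * e] is the error from the strips of width [2 * e], and [B / Num.sqrt m] the discretization
   error. *)
pose A := Num.sqrt 2 * K * (2 * (M + M)); pose B := 2 * (K * (M + M)).
have A0 : 0 <= A by rewrite !mulr_ge0 ?sqrtr_ge0 ?addr_ge0 // ltW.
have B0 : 0 <= B by rewrite !mulr_ge0 ?addr_ge0 // ltW.
pose J := (\int[(@lebesgue_measure R \x @lebesgue_measure R)]_z (dist_gamma gamma z)%:E)%E.
have bounds m e : (0 < m)%N -> 0 < e -> e <= 1 ->
    (forall x, `|gamma x - boundary (lam m) x| <= e) ->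
    (((worst_case (lam m))%:R / (m%:R * Num.sqrt m%:R))%:E <= J + (A * e)%:E)%E /\
    (J <= ((worst_case (lam m))%:R / (m%:R * Num.sqrt m%:R) +
           B / Num.sqrt m%:R + A * e)%:E)%E.
  move=> m0 e0 e1 close; have /and3P[srt _ /eqP sm] := lam_part m m0.
  have s0 : (0 < sumn (lam m))%N by rewrite sm.
  have bbm := bb m m0 (fun x => le_trans (close x) e1).
  have up x : boundary (lam m) x <= gamma x + e.
    by have := close x; rewrite ler_norml => /andP[h _]; lra.
  have dn x : gamma x <= boundary (lam m) x + e.
    by have := close x; rewrite ler_norml => /andP[_ h]; lra.
  have := worst_case_le_integral srt s0 lip gb bbm e0 M0 K0 up.
  have := integral_le_worst_case srt s0 lip gb e0 M0 K0 dn.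
  rewrite sm -/J => h1 h2; split.
    by apply: le_trans h2 _; rewrite leeD2l // lee_fin /A; lra.
  apply: le_trans h1 _; rewrite lee_fin /A /B; lra.
(* One index whose boundary is within 1 of [gamma] is enough for finiteness. *)
have [I hI] : exists I, J = I%:E.
  have J0 : (0 <= J)%E.
    by apply: integral_ge0 => z _; rewrite lee_fin (dist_gamma_ge0 lip gb).
  have [m [m0 close]] := filter_ex
    (@filterI _ \oo _ _ _ (nbhs_infty_gt 0%N) (converges_uniformly_near lam_cvg ltr01)).
  have [_] := bounds m 1 m0 ltr01 (lexx 1) close.
  by case: (J) J0 => [r| |] // _ _; exists r.
rewrite (region_integral hg hI).
apply/eqaddoP => eps eps0.
(* This gives [A * e <= eps / 2]; [A + 1] keeps the denominator positive, and the cap 1 is the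
   closeness required for the uniform constants. *)
pose e := Num.min 1 (eps / (2 * (A + 1))).
have e0 : 0 < e by rewrite lt_min ltr01 divr_gt0 // mulr_gt0 //; lra.
have e1 : e <= 1 by rewrite ge_min lexx.
have Ae : A * e <= eps / 2.
  have le : e <= eps / (2 * (A + 1)) by rewrite ge_min lexx orbT.
  apply: le_trans (_ : (A + 1) * (eps / (2 * (A + 1))) <= _).
    by apply: ler_pM => //; lra.
  have A1 : A + 1 != 0 by rewrite gt_eqF //; lra.
  by rewrite [X in X <= _](_ : _ = eps / 2) //; field.
near=> m.
have m0 : (0 < m)%N by near: m; exact: nbhs_infty_gt.
have close : forall x, `|gamma x - boundary (lam m) x| <= e.
  by near: m; exact: converges_uniformly_near.
have Bm : B / Num.sqrt m%:R <= eps / 2.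
  have : (2 * B / eps) ^+ 2 <= m%:R by near: m; exact: nbhs_infty_ger.
  move=> /(@ler_wsqrtr R); rewrite sqrtr_sqr ger0_norm; last first.
    by apply: divr_ge0; [apply: mulr_ge0|exact: ltW].
  rewrite ler_pdivrMr // ler_pdivrMr ?sqrtr_gt0 ?ltr0n //; lra.
have [h1 h2] := bounds m e m0 e0 e1 close.
move: h1 h2; rewrite hI -EFinD !lee_fin => h1 h2.
have q0 : 0 < m%:R * Num.sqrt m%:R :> R by rewrite mulr_gt0 ?sqrtr_gt0 ?ltr0n.
rewrite !fctE powR_3half ?ltr0n // [`|_ * Num.sqrt _|]gtr0_norm //.
(* After division by [m%:R * Num.sqrt m%:R], the two bounds leave an error of at most [eps / 2]
   above and [eps] below. *)
rewrite -ler_pdivrMr // -[X in _ / X]gtr0_norm // -normf_div mulrBl.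
rewrite [_ * I / _]mulrAC divff ?gt_eqF // mul1r.
by rewrite ler_norml; apply/andP; split; lra.
Unshelve. all: by end_near. Qed.
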